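(* Let $B=B(n)=\Theta(n)$ be the budget, with additive utility. There exist (for each number $n$ of workers) a worker profile distribution $[f_i]_{i\in\mathcal N}$ and a worker arrival ordering $\sigma$ such that no common pricing without bonus is $(\delta,o(n))$-approximate to $\mathrm{OPP}(B)$ for any $\delta\in(0,1]$. That is, for every $\delta\in(0,1]$ and every sequence $\gamma_n\ge1$ with $\gamma_n=o(n)$, for all sufficiently large $n$ every common pricing without bonus $p$ satisfies $$U(\gamma_nB;p)<\delta\,U\big(B;p^\star(B)\big),$$ where $p^\star(B)$ is an optimal personalized pricing of $\mathrm{OPP}(B)$.
   Context: Workers: $\mathcal N=\{1,\dots,n\}$. Worker $i$ has a random private profile $(s_i,c_i)\in\mathbb R_{\ge0}^2$ (quality, cost) with law $f_i$, known to the requester; profiles are independent across workers. Reasonable workers: there is a constant $C$ such that $\mathbb P[s_i/c_i<C]=1$ for every $i$. Pricing: a (personalized) pricing policy is $p=[p_i]_{i\in\mathcal N}$ with each $p_i:\mathbb R_{\ge0}\to\mathbb R_{\ge0}$ increasing (not necessarily strictly; constants are allowed); worker $i$, if recruited, is paid $p_i(s_i)$. The constant term of $p_i$ is the base payment and the rest is the bonus payment. A common pricing is a policy with $p_i=p$ for all $i$, for a single function $p$; it is without bonus if $p$ is a constant function. Allocation process: given $p$, a budget $B$ and an ordering $\sigma$ of $\mathcal N$, workers arrive in the order $\sigma$. When worker $i$ arrives: if the remaining budget is smaller than worker $i$'s maximal possible reward (the largest possible value of $p_i(s_i)$), she is discarded ($x_i=0$); otherwise she accepts iff $p_i(s_i)\ge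 c_i$; if she accepts, $x_i=1$ and $p_i(s_i)$ is deducted from the remaining budget; otherwise $x_i=0$. The law of the resulting $\vec x\in\{0,1\}^n$ (random through the profiles) is denoted $\mathcal P(p,B,\sigma)$. Utility: $u(\vec s\circ\vec x)=\sum_{i\in\mathcal N}s_ix_i$ (additive), and $U(B;p):=\mathbb E_{\vec x\sim\mathcal P(p,B,\sigma)}[u(\vec s\circ\vec x)]$. $\mathrm{OPP}(B)$ is the problem of maximizing $U(B;p)$ over all personalized pricing policies $p=[p_i]$; $p^\star(B)$ denotes a maximizer. For $0\le\delta\le1$ and $\gamma\ge1$, a common pricing $p_c$ is $(\delta,\gamma)$-approximate to $\mathrm{OPP}(B)$ if $U(\gamma B;p_c)\ge\delta\,U(B;p^\star(B))$. *)

(* Defs.v *)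
From HB Require Import structures.
From mathcomp Require Import all_boot all_order all_algebra all_fingroup.
From mathcomp Require Import all_classical all_reals all_analysis ess_sup_inf.

Set Implicit Arguments.
Unset Strict Implicit.
Unset Printing Implicit Defensive.

Import Order.TTheory GRing.Theory Num.Theory.
Import numFieldNormedType.Exports.

Local Open Scope classical_set_scope.
Local Open Scope ring_scope.

Section product_law.
Context {R : realType} {d : measure_display} {T : measurableType d}.

Definition tcons n (x : T * n.-tuple T) : n.+1.-tuple T :=
  [tuple of x.1 :: x.2].

Lemma measurable_tcons n : measurable_fun [set: T * n.-tuple T] (@tcons n).
Proof. exact: measurable_cons. Qed.

HB.instance Definition _ n :=
  isMeasurableFun.Build _ _ _ _ (@tcons n) (@measurable_tcons n).

(* Joint law of independent coordinates with laws [f i]; it is characterised by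
   [product_lawE] below. *)
Fixpoint product_law n : ('I_n -> probability T R) ->
    probability (n.-tuple T) R :=
  match n with
  | 0 => fun _ => \d_([tuple] : 0.-tuple T)
  | m.+1 => fun f =>
      distribution (f ord0 \x product_law (fun i => f (lift ord0 i)))%E
        (@tcons m)
  end.

Lemma product_lawE n (f : 'I_n -> probability T R) (A : 'I_n -> set T) :
  (forall i, measurable (A i)) ->
  product_law f [set t | forall i, A i (tnth t i)] = (\prod_i f i (A i))%E.
Proof.
elim: n f A => [|n IH] f A mA.
  by rewrite big_ord0 /= diracE mem_set// => -[].
rewrite big_ord_recl -IH; last by move=> i; exact: mA.
rewrite /= /distribution /pushforward/= -product_measure1E//; last first.
  have -> : [set t : n.-tuple T | forall i, A (lift ord0 i) (tnth t i)] =
      \bigcap_(i in [set: 'I_n]) ((@tnth _ T ^~ i) @^-1` A (lift ord0 i)).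
    by apply/seteqP; split => [t At i _|t At i]; exact: At.
  apply: fin_bigcap_measurable => // i _; rewrite -[_ @^-1` _]setTI.
  exact: measurable_tnth.
congr (product_measure1 _ _ _).
apply/seteqP; split => [[x t] /= At|[x t] /= [Ax At] i].
  split; first exact: (At ord0).
  by move=> i; have := At (lift ord0 i); rewrite tnthS.
by have [j|] := unliftP ord0 i => [->|->]; rewrite ?tnthS//; exact: At.
Qed.

End product_law.

Section crowdsourcing.
Context {R : realType}.

Definition quality (w : R * R) : R := w.1.
Definition cost (w : R * R) : R := w.2.

Definition profile_law (f : probability (R * R)%type R) : Prop :=
  f [set w | 0 <= quality w /\ 0 <= cost w] = 1%E.

(* [0 < cost w] makes the quotient meaningful, since [x / 0 = 0]. *)
Definition reasonable (C : R) (f : probability (R * R)%type R) : Prop :=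
  f [set w | 0 < cost w /\ quality w / cost w < C] = 1%E.

(* A payment rule is a function on the nonnegative reals; its values at negative
   arguments are unconstrained and irrelevant. *)
Definition pricing (q : R -> R) : Prop :=
  (forall s, 0 <= s -> 0 <= q s) /\
  (forall s t, 0 <= s -> s <= t -> q s <= q t).

Definition without_bonus (q : R -> R) : Prop :=
  exists a, forall s, 0 <= s -> q s = a.

Section market.
Variables (n : nat) (f : 'I_n -> probability (R * R)%type R).
Implicit Types (p : 'I_n -> R -> R) (w : n.-tuple (R * R)%type).

Definition policy p : Prop := forall i, pricing (p i).

(* The largest possible value of [p i (s_i)], up to null sets of [f i]. *)
Definition max_reward p (i : 'I_n) : \bar R :=
  ess_sup (f i) (fun x => (p i (quality x))%:E).

(* The workers recruited among those in [l], arriving in this order, when the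
   remaining budget is [b] and the realized profiles are [w]. *)
Fixpoint recruited p w (b : R) (l : seq 'I_n) : {set 'I_n} :=
  match l with
  | [::] => finset.set0
  | i :: l' =>
      let reward := p i (quality (tnth w i)) in
      if (b%:E < max_reward p i)%E then recruited p w b l'
      else if cost (tnth w i) <= reward then
        (i |: recruited p w (b - reward) l')%SET
      else recruited p w b l'
  end.

(* [sigma k] is the [k]-th worker to arrive. *)
Definition arrivals (sigma : 'S_n) : seq 'I_n := [seq sigma k | k <- enum 'I_n].

Definition allocation p (B : R) (sigma : 'S_n) w (i : 'I_n) : bool :=
  i \in recruited p w B (arrivals sigma).

Definition additive_utility (v : 'I_n -> R) : R := \sum_i v i.

Definition realized_utility (sigma : 'S_n) (B : R) p w : R :=
  additive_utility
    (fun i => quality (tnth w i) * (allocation p B sigma w i)%:R).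

Definition expected_utility (sigma : 'S_n) (B : R) p : \bar R :=
  'E_(product_law f)[realized_utility sigma B p].

Definition optimal_policy (sigma : 'S_n) (B : R) p : Prop :=
  policy p /\
  forall p', policy p' ->
    (expected_utility sigma B p' <= expected_utility sigma B p)%E.

End market.
End crowdsourcing.

(* Main.v *)
(* All profiles are deterministic: every worker has cost [B], and only the last
   worker to arrive has nonzero quality, namely [B]. Paying every worker her own
   quality spends the whole budget on the last worker and recruits nobody else,
   which is optimal with utility [B]. A constant price that she accepts is at
   least [B] and is accepted by everybody, so she is reached only if the budget
   is at least [n * B], and [gamma_n * B < n * B] eventually. *)
Require Import Defs.
From mathcomp Require Import all_boot all_order all_algebra all_fingroup.
From mathcomp Require Import all_classical all_reals all_analysis.
From mathcomp Require Import ess_sup_inf measurable_realfun.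
Import Order.TTheory GRing.Theory Num.Theory.
Import numFieldNormedType.Exports.
Import HBNNSimple.
Local Open Scope classical_set_scope.
Local Open Scope ring_scope.

(** * Integrals and essential suprema against a point mass *)

(** The integral is a supremum over simple functions below [g]. Each such [h] integrates to [h a],
    and [g a] times the indicator of [[set a]] attains the supremum, so [g] may be any function. *)
Lemma ge0_integral_dirac_fin {d : measure_display} {T : measurableType d}
    {R : realType} (a : T) (g : T -> \bar R) :
  measurable [set a] -> (forall x, 0 <= g x)%E -> g a \is a fin_num ->
  (\int[dirac a]_x g x = g a)%E.
Proof.
move=> ma g0 ga; rewrite ge0_integralTE//.
have sintE (h : {nnsfun T >-> R}) :
    sintegral (dirac a : {measure set T -> \bar R}) h = (h a)%:E.
  rewrite -integralT_nnsfun integral_dirac//; first by rewrite diracT mul1e.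
  exact/measurable_EFinP.
apply/eqP; rewrite eq_le; apply/andP; split.
  by apply: ge_ereal_sup => _ [h hg <-]; rewrite sintE.
apply: ereal_sup_ubound.
have r0 : 0 <= fine (g a) by rewrite fine_ge0.
exists (scale_nnsfun (indic_nnsfun R ma) r0); last first.
  by rewrite sintE /= mindicE mem_set// mulr1 fineK.
move=> x /=; rewrite mindicE; have [|] := boolP (x \in [set a]).
  by rewrite inE => ->; rewrite mulr1 fineK.
by rewrite mulr0.
Qed.

Lemma eq_dirac {d : measure_display} {T : measurableType d}
    {R : realType} (P : probability T R) (a : T) (A : set T) :
  measurable [set a] -> P [set a] = 1%E -> measurable A -> P A = \d_a A.
Proof.
move=> ma Pa mA; rewrite diracE.
have [/set_mem Aa|/negP aA] := boolP (a \in A); apply/eqP; rewrite eq_le.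
  rewrite probability_le1//= -[leLHS]Pa le_measure// ?inE//.
  by move=> x ->.
rewrite measure_ge0 andbT (_ : _%:E = P (~` [set a])).
  rewrite le_measure// ?inE//; first exact: measurableC.
  by move=> x Ax xa; apply: aA; rewrite inE -xa.
by rewrite probability_setC// [X in (_ - X)%E]Pa subee.
Qed.

(* Unlike [integral_dirac], [X] is not assumed to be measurable: a pricing
   policy is arbitrary on negative qualities. *)
Lemma expectation_atom {d : measure_display} {T : measurableType d}
    {R : realType} (P : probability T R) (a : T) (X : T -> R) :
  measurable [set a] -> P [set a] = 1%E -> ('E_P[X] = (X a)%:E)%E.
Proof.
move=> ma Pa; rewrite unlock.
rewrite (@eq_measure_integral _ _ _ setT (dirac a)); last first.
  by move=> A mA _; exact: eq_dirac.
rewrite integralE !ge0_integral_dirac_fin//.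
- by rewrite -[RHS]/((EFin \o X) a) [in RHS](funeposneg (EFin \o X)).
- by rewrite funenegE -EFinN -EFin_max.
- by rewrite funeposE -EFin_max.
Qed.

Lemma ess_sup_dirac {d : measure_display} {T : measurableType d}
    {R : realType} (a : T) (g : T -> \bar R) :
  measurable [set a] -> ess_sup (@dirac _ T a R) g = g a.
Proof.
move=> ma; apply: ess_sup_ae_cst; first by rewrite /= diracT lte01.
exists (~` [set a]); split; first exact: measurableC.
  by rewrite /= diracE memNset// => /(_ erefl).
by move=> x /= gx xa; apply: gx; rewrite xa.
Qed.

Lemma measurable_set1_prod {R : realType} (w : R * R) : measurable [set w].
Proof.
rewrite (_ : [set w] = [set w.1] `*` [set w.2]); first exact: measurableX.
by case: w => x y; apply/seteqP; split => [[u v] [-> ->]|[u v] [/= -> ->]].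
Qed.

Lemma tuple_set1E {T : Type} {n : nat} (w : n.-tuple T) :
  [set w] = [set t | forall i, tnth t i = tnth w i].
Proof. by apply/seteqP; split => [_ ->|t tw] //=; apply: eq_from_tnth. Qed.

Lemma measurable_set1_tuple {d : measure_display} {T : measurableType d}
    {n : nat} (w : n.-tuple T) :
  (forall x : T, measurable [set x]) -> measurable [set w].
Proof.
move=> m1; rewrite tuple_set1E.
have -> : [set t : n.-tuple T | forall i, tnth t i = tnth w i] =
    \bigcap_(i in [set: 'I_n]) ((@tnth _ T ^~ i) @^-1` [set tnth w i]).
  by apply/seteqP; split => [t At i _|t At i]; exact: At.
apply: fin_bigcap_measurable => // i _; rewrite -[_ @^-1` _]setTI.
exact: measurable_tnth.
Qed.

(** * Recruitment along a list of arrivals *)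

Section recruitment.
Context {R : realType} {n : nat}.
Variables (f : 'I_n -> probability (R * R)%type R) (p : 'I_n -> R -> R).
Variable w : n.-tuple (R * R)%type.

Let reward (i : 'I_n) := p i (quality (tnth w i)).

(** A worker offered less than her cost leaves the budget intact, whether she is discarded or
    refuses. *)
Lemma recruited_rcons_refused (b : R) (l : seq 'I_n) (x : 'I_n) :
  (forall i, i \in l -> reward i < cost (tnth w i)) ->
  recruited f p w b (rcons l x) = recruited f p w b [:: x].
Proof.
elim: l b => // i l IH b refl.
have IHl b' : recruited f p w b' (rcons l x) = recruited f p w b' [:: x].
  by apply: IH => j jl; apply: refl; rewrite inE jl orbT.
have /lt_geF iF := refl i (mem_head _ _).
by rewrite rcons_cons [LHS]/= -/(reward i) iF IHl; case: ifP.
Qed.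

(** If [x] accepts [a], so does everyone before her who is not discarded, and each acceptance lowers
    the budget by [a]. *)
Lemma recruited_last_budget (a c b : R) (l : seq 'I_n) (x : 'I_n) :
  (forall i, reward i = a) -> (forall i, max_reward f p i = a%:E) ->
  (forall i, cost (tnth w i) = c) -> 0 <= c ->
  x \notin l -> x \in recruited f p w b (rcons l x) ->
  c <= a /\ (size l).+1%:R * a <= b.
Proof.
move=> rE mE cE c0; elim: l b => [|i l IH] b.
  rewrite /= mE lte_fin -/(reward x) rE cE; case: ltP => [|ab _]; rewrite ?inE//.
  by case: ifP => [ca|]; rewrite ?inE// mul1r.
rewrite inE negb_or => /andP[xi xl].
rewrite rcons_cons /= mE lte_fin -/(reward i) rE cE.
case: ltP => [ba /(IH _ xl)[ca lab]|ab].
  (* A discarded worker means a budget below [a], but the induction hypothesis makes it at least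
     [a], since [a] is nonnegative. *)
  split=> //; move: ba; rewrite ltNge => /negP[]; apply: le_trans lab.
  by rewrite ler_peMl ?(le_trans c0)// ler1n.
case: ifP => [ca|/negP nca /(IH _ xl)[]//].
rewrite !inE (negbTE xi) /= => /(IH _ xl)[_].
by rewrite lerBrDl [in X in _ -> X]mulrS mulrDl mul1r.
Qed.

End recruitment.

(** * Markets with deterministic profiles *)

Section deterministic_market.
Context {R : realType} {n : nat}.
Variable w : 'I_n -> R * R.

Definition deterministic (i : 'I_n) : probability (R * R)%type R := \d_(w i).

(** A product of point masses gives mass 1 to the single tuple [mktuple w]. *)
Lemma expected_utility_deterministic (sigma : 'S_n) (b : R)
    (p : 'I_n -> R -> R) :
  expected_utility deterministic sigma b p =
  (realized_utility deterministic sigma b p (mktuple w))%:E.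
Proof.
apply: expectation_atom.
  by apply: measurable_set1_tuple; exact: measurable_set1_prod.
have m1 := @measurable_set1_prod R.
rewrite tuple_set1E.
rewrite (@product_lawE _ _ _ n _ (fun i => [set tnth (mktuple w) i]))//.
by apply: big1 => i _; rewrite tnth_mktuple /= diracE mem_set.
Qed.

Lemma max_reward_deterministic (p : 'I_n -> R -> R) (i : 'I_n) :
  max_reward deterministic p i = (p i (quality (w i)))%:E.
Proof. by rewrite /max_reward ess_sup_dirac//; exact: measurable_set1_prod. Qed.

End deterministic_market.

(** * The market in which only the last arrival has value *)

Section last_worker_market.
Context {R : realType} {n : nat}.
Variable b : R.

(* A reasonable profile needs a positive cost even where the budget is [0]. *)
Definition common_cost : R := if 0 < b then b else 1.

(** The test [i.+1 == n], unlike a comparison with [ord_max], makes sense for every [n], including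
    0. *)
Definition last_worker_quality (i : 'I_n) : R :=
  if i.+1 == n then b else 0.

Definition last_worker_profile (i : 'I_n) : R * R :=
  (last_worker_quality i, common_cost).

Definition last_worker_law := deterministic last_worker_profile.

(** The quality is known in advance, so it is paid as a base payment, which is trivially
    increasing. *)
Definition pay_quality (i : 'I_n) : R -> R := fun=> last_worker_quality i.

Lemma common_cost_gt0 : 0 < common_cost.
Proof. by rewrite /common_cost; case: ifP. Qed.

Lemma last_worker_quality_bounds (i : 'I_n) :
  0 <= b -> 0 <= last_worker_quality i <= common_cost.
Proof.
move=> b0; rewrite /last_worker_quality; case: ifP => _.
  by rewrite b0 /common_cost; case: ltP => [_|/le_trans->//]; rewrite lexx.
by rewrite lexx ltW// common_cost_gt0.
Qed.

End last_worker_market.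

Lemma last_worker_qualityE {R : realType} (n : nat) (b : R) (i : 'I_n.+1) :
  last_worker_quality b i = if i == ord_max then b else 0.
Proof. by rewrite /last_worker_quality eqSS. Qed.

Lemma last_worker_utility {R : realType} (n : nat) (b m : R)
    (p : 'I_n.+1 -> R -> R) :
  expected_utility (@last_worker_law R n.+1 b) 1%g m p =
  (b * (ord_max \in recruited (@last_worker_law R n.+1 b) p
     (mktuple (last_worker_profile b)) m (enum 'I_n.+1))%:R)%:E.
Proof.
rewrite expected_utility_deterministic; congr EFin.
rewrite /realized_utility /additive_utility big_ord_recr /= big1 => [|i _].
  rewrite add0r tnth_mktuple /= last_worker_qualityE eqxx /allocation.
  rewrite /arrivals (_ : [seq _ | k <- _] = enum 'I_n.+1)//.
  by rewrite -[RHS]map_id; apply: eq_map => k; rewrite perm1.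
rewrite tnth_mktuple /= last_worker_qualityE ifN ?mul0r//.
by rewrite -val_eqE /= ltn_eqF.
Qed.

Lemma last_not_widened {n : nat} :
  (ord_max : 'I_n.+1) \notin map (widen_ord (leqnSn n)) (enum 'I_n).
Proof.
apply/mapP => -[i _ /(congr1 val)/= nE].
by have := ltn_ord i; rewrite -nE ltnn.
Qed.

Lemma pay_quality_utility {R : realType} (n : nat) (b : R) :
  (0 < n)%N -> 0 <= b ->
  expected_utility (@last_worker_law R n b) 1%g b (@pay_quality R n b) = b%:E.
Proof.
case: n => // n _ b0; rewrite last_worker_utility; congr EFin.
(* For [b = 0] the common cost is 1 and nobody accepts, but both sides vanish. *)
have [->|bN0] := eqVneq b 0; first by rewrite mul0r.
have bgt0 : 0 < b by rewrite lt_neqAle eq_sym bN0.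
rewrite enum_ordSr recruited_rcons_refused; last first.
  move=> _ /mapP[i _ ->]; rewrite tnth_mktuple /= /pay_quality.
  rewrite last_worker_qualityE ifN ?common_cost_gt0//.
  by rewrite -val_eqE /= ltn_eqF.
rewrite /= max_reward_deterministic /pay_quality last_worker_qualityE eqxx.
by rewrite ltxx tnth_mktuple /= /common_cost bgt0 lexx !inE eqxx mulr1.
Qed.

(** Any policy earns [b] times the indicator that the last worker is recruited, hence at most
    [b]. *)
Lemma pay_quality_optimal {R : realType} (n : nat) (b : R) :
  0 <= b ->
  optimal_policy (@last_worker_law R n b) 1%g b (@pay_quality R n b).
Proof.
move=> b0; split=> [i|p' _].
  by split=> // s _; rewrite /pay_quality /last_worker_quality; case: ifP.
case: n p' => [|n] p'.
  rewrite !expected_utility_deterministic /realized_utility /additive_utility.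
  by rewrite !big_ord0.
rewrite pay_quality_utility// last_worker_utility lee_fin ler_piMr//.
by case: (_ \in _).
Qed.

Lemma common_pricing_utility {R : realType} (n : nat) (b m : R) (q : R -> R) :
  (0 < n)%N -> 0 < b -> m < n%:R * b -> without_bonus q ->
  expected_utility (@last_worker_law R n b) 1%g m (fun=> q) = 0%E.
Proof.
case: n => // n _ b0 mb [a qa]; rewrite last_worker_utility.
rewrite (_ : _ \in _ = false) ?mulr0//; apply/negP.
have qE (i : 'I_n.+1) : q (last_worker_quality b i) = a.
  by apply: qa; rewrite /last_worker_quality; case: ifP => // _; exact: ltW.
rewrite enum_ordSr => /(@recruited_last_budget _ _ _ _ _ a b) [].
- by move=> i; rewrite tnth_mktuple qE.
- by move=> i; rewrite max_reward_deterministic qE.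
- by move=> i; rewrite tnth_mktuple /= /common_cost b0.
- exact: ltW.
- exact: last_not_widened.
(* Recruiting the last worker needs [n.+1%:R * a <= m] with [b <= a], against [m < n.+1%:R * b]. *)
move=> ba; rewrite size_map size_enum_ord leNgt (lt_le_trans mb)//.
by rewrite ler_wpM2l.
Qed.

Theorem theorem3 (R : realType) (B : nat -> R)
    (B_ge0 : forall n, 0 <= B n)
    (B_Theta : (B : nat -> R^o) =Theta_\oo (fun n => n%:R : R^o)) :
  exists (C : R)
         (f : forall n, 'I_n -> probability (R * R)%type R)
         (sigma : forall n, 'S_n)
         (pstar : forall n, 'I_n -> R -> R),
    (forall n i, profile_law (f n i) /\ reasonable C (f n i)) /\
    (forall n, optimal_policy (f n) (sigma n) (B n) (pstar n)) /\
    forall (delta : R) (gamma : nat -> R),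
      0 < delta -> delta <= 1 ->
      (forall n, 1 <= gamma n) ->
      (gamma : nat -> R^o) =o_\oo (fun n => n%:R : R^o) ->
      \forall n \near \oo, forall q : R -> R,
        pricing q -> without_bonus q ->
        (expected_utility (f n) (sigma n) (gamma n * B n) (fun _ => q) <
         delta%:E * expected_utility (f n) (sigma n) (B n) (pstar n))%E.
Proof.
(* Quality never exceeds cost, so the ratio is at most 1; the strict bound holds with 2. *)
exists 2, (fun n => @last_worker_law R n (B n)), (fun=> 1%g),
  (fun n => @pay_quality R n (B n)); split=> [n i|].
  have c0 := common_cost_gt0 (B n).
  have /andP[q0 qc] := last_worker_quality_bounds _ i (B_ge0 n).
  split; rewrite /profile_law /reasonable /= diracE mem_set//=.
    by split=> //; exact: ltW.
  split=> //; rewrite ltr_pdivrMr// (le_lt_trans qc)//.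
  by rewrite ltr_pMl// ltr1n.
split=> [n|delta gamma delta0 _ gamma1 gammao]; first exact: pay_quality_optimal.
move: B_Theta; rewrite eqThetaE qualifE => /asboolP[[k k'] /= /andP[k0 _] kB].
(* Any constant in (0,1) serves here: it turns [gamma = o(n)] into [gamma n < n] eventually. *)
have half0 : 0 < 2^-1 :> R by rewrite invr_gt0.
have /eqoP/(_ _ half0) gamma_half := gammao.
near=> n => q _ qa.
have n0 : (0 < n)%N by near: n; exists 1%N.
have nR0 : 0 < n%:R :> R by rewrite ltr0n.
(* The lower Theta bound makes the budget eventually positive, so that the optimum [B n] strictly
   beats the common pricing's 0. *)
have B0 : 0 < B n.
  have [kBn _] : k * `|n%:R : R^o| <= `|B n : R^o| /\
      `|B n : R^o| <= k' * `|n%:R : R^o|.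
    by near: n.
  by move: kBn; rewrite !ger0_norm//; apply: lt_le_trans; rewrite mulr_gt0.
have gn : gamma n < n%:R.
  have : `|gamma n : R^o| <= 2^-1 * `|n%:R : R^o| by near: n.
  rewrite (ger0_norm (ltW nR0)) ger0_norm ?(le_trans ler01)// => /le_lt_trans; apply.
  by rewrite gtr_pMl// invf_lt1// ltr1n.
rewrite common_pricing_utility ?ltr_pM2r// pay_quality_utility//.
by rewrite -EFinM lte_fin mulr_gt0.
Unshelve. all: by end_near.
Qed.
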